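(* Let $\langle[0,1],\oplus_p\rangle$ be a convex algebra satisfying (MO), (UC) and (LC), and let $E^\oplus$ and $\Delta^\oplus$ be as defined in the context. (i) Assume that $\max E^\oplus<1$. Then the subalgebra $\langle[\max E^\oplus,1],\oplus_p\rangle$ is isomorphic to $\langle[0,1],+_p\rangle$. There exist exactly two isomorphisms between them, one of which is increasing and the other decreasing. (ii) For each $(a,b)\in\Delta^\oplus$ there exists a unique element $\tau\in\{1,\infty\}$ such that the subalgebra $\langle[a,b),\oplus_p\rangle$ is isomorphic to $\langle[0,\tau),+_p\rangle$. Every isomorphism of $\langle[a,b),\oplus_p\rangle$ onto $\langle[0,\tau),+_p\rangle$ is increasing. If $\tau=1$, this isomorphism is unique.
   Context: A convex algebra $\langle X,\oplus_p\rangle$ is a set $X$ with binary operations $\oplus_p$, $p\in(0,1)$, satisfying, for all $x,y,z\in X$ and $p,q\in(0,1)$: $x\oplus_p x=x$; $x\oplus_p y=y\oplus_{1-p}x$; and $(x\oplus_p y)\oplus_q z=x\oplus_{pq}\big(y\oplus_{\frac{(1-p)q}{1-pq}}z\big)$. One also sets $x\oplus_1 y=x$ and $x\oplus_0 y=y$. Homomorphisms/isomorphisms are maps preserving all $\oplus_p$. For a convex subset $X\subseteq\mathbb R$ (possibly unbounded), $+_p$ denotes $x+_p y=px+(1-p)y$. On $[0,1]$, order and topology are the usual ones. Conditions on a convex algebra $\langle[0,1],\oplus_p\rangle$: (MO): for all $x,x',y\in[0,1]$ and $p\in(0,1)$, $x\le x'$ implies $x\oplus_p y\le x'\oplus_p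 y$. (UC): for all $x,y\in[0,1)$ and $p\in(0,1)$, $\limsup_{\varepsilon\to0+}[(x+\varepsilon)\oplus_p(y+\varepsilon)]\le x\oplus_p y$. (LC): for all $x,y\in[0,1]$ with $x\le y$, $\liminf_{p\to1-}[y\oplus_p x]\ge y$. Write $y\triangleright x$ (''$y$ eats $x$'') if $y\oplus_t x=y$ for all $t\in(0,1]$. Set $E^\oplus=\{y\in[0,1]: y\triangleright 0\}$ and $\Delta^\oplus=\{(a,b)\in[0,1]^2: a,b\in E^\oplus,\ a<b,\ (a,b)\cap E^\oplus=\emptyset\}$. *)

(* Defs.v *)
From mathcomp Require Export all_boot all_order all_algebra.
From mathcomp Require Export all_classical all_reals all_analysis.
Export Order.TTheory GRing.Theory Num.Theory.
Export numFieldNormedType.Exports.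

Set Implicit Arguments.
Unset Strict Implicit.
Unset Printing Implicit Defensive.

Local Open Scope classical_set_scope.
Local Open Scope ring_scope.

(* The carrier of an algebra is a set X in an ambient type and its operations
   are the restrictions to X of a total [op : R -> T -> T -> T]; a subalgebra is
   then a smaller carrier with the same [op].  Nothing is assumed of [op p x y]
   when p is not in (0,1) or when x or y is not in X. *)

Definition op_closed (R : realType) (T : Type) (X : set T)
    (op : R -> T -> T -> T) : Prop :=
  forall p x y, 0 < p < 1 -> X x -> X y -> X (op p x y).

Definition convex_algebra (R : realType) (T : Type) (X : set T)
    (op : R -> T -> T -> T) : Prop :=
  [/\ op_closed X op,
      forall p x, 0 < p < 1 -> X x -> op p x x = x,
      forall p x y, 0 < p < 1 -> X x -> X y -> op p x y = op (1 - p) y x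
    & forall p q x y z, 0 < p < 1 -> 0 < q < 1 -> X x -> X y -> X z ->
        op q (op p x y) z
        = op (p * q) x (op ((1 - p) * q / (1 - p * q)) y z)].

Definition subalgebra (R : realType) (T : Type) (X : set T)
    (op : R -> T -> T -> T) (Y : set T) : Prop :=
  Y `<=` X /\ op_closed Y op.

(* Only the restriction of f to X is meaningful, so equality of isomorphisms is
   pointwise equality on X. *)
Definition isomorphism (R : realType) (T U : Type)
    (X : set T) (opX : R -> T -> T -> T) (Y : set U) (opY : R -> U -> U -> U)
    (f : T -> U) : Prop :=
  set_bij X Y f /\
  forall p x y, 0 < p < 1 -> X x -> X y -> f (opX p x y) = opY p (f x) (f y).

Definition isomorphic (R : realType) (T U : Type)
    (X : set T) (opX : R -> T -> T -> T) (Y : set U) (opY : R -> U -> U -> U)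
    : Prop :=
  exists f, isomorphism X opX Y opY f.

Definition eq_on (T U : Type) (X : set T) (f g : T -> U) : Prop :=
  forall x, X x -> f x = g x.

Definition increasing_on (R : realType) (X : set R) (f : R -> R) : Prop :=
  forall x y, X x -> X y -> x < y -> f x < f y.

Definition decreasing_on (R : realType) (X : set R) (f : R -> R) : Prop :=
  forall x y, X x -> X y -> x < y -> f y < f x.

Definition is_max (R : realType) (A : set R) (m : R) : Prop :=
  A m /\ ubound A m.

Definition plus_op (R : realType) (p x y : R) : R := p * x + (1 - p) * y.

(* The convention extending the operations to the weights 0 and 1. *)
Definition ext_op (R : realType) (T : Type) (op : R -> T -> T -> T)
    (p : R) (x y : T) : T :=
  if p == 1 then x else if p == 0 then y else op p x y.

Definition eats (R : realType) (T : Type) (op : R -> T -> T -> T) (y x : T)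
    : Prop :=
  forall t, 0 < t <= 1 -> ext_op op t y x = y.

Definition MO (R : realType) (op : R -> R -> R -> R) : Prop :=
  forall x x' y p, 0 <= x <= 1 -> 0 <= x' <= 1 -> 0 <= y <= 1 -> 0 < p < 1 ->
    x <= x' -> op p x y <= op p x' y.

Definition UC (R : realType) (op : R -> R -> R -> R) : Prop :=
  forall x y p, 0 <= x < 1 -> 0 <= y < 1 -> 0 < p < 1 ->
    (limf_esup (fun eps : R => (op p (x + eps) (y + eps))%:E) 0^'+
       <= (op p x y)%:E)%E.

Definition LC (R : realType) (op : R -> R -> R -> R) : Prop :=
  forall x y, 0 <= x <= 1 -> 0 <= y <= 1 -> x <= y ->
    (y%:E <= limf_einf (fun p : R => (op p y x)%:E) 1^'-)%E.

Definition Eset (R : realType) (op : R -> R -> R -> R) : set R :=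
  [set y | 0 <= y <= 1 /\ eats op y 0].

Definition Delta (R : realType) (op : R -> R -> R -> R) : set (R * R) :=
  [set ab | [/\ Eset op ab.1, Eset op ab.2, ab.1 < ab.2
              & `]ab.1, ab.2[ `&` Eset op = set0]].

(* [0, tau), where tau may be +oo *)
Definition half_open (R : realType) (tau : \bar R) : set R :=
  [set x | 0 <= x /\ (x%:E < tau)%E].

(* Main.v *)
(* If a eats 0 and no element of (a, x] does, then the homomorphism
   t |-> op t x a from [0, 1] to [a, x] is an isomorphism.  It is strictly
   increasing: [op p y 0 = y] for a single weight p would propagate to all
   weights and put y into E, and [op p x a = a] for a single weight would
   propagate to weights arbitrarily close to 1, against (LC).  It is onto because
   it has no jumps, by (LC) and (UC).  For a = max E take x = 1; for [a, b) the
   coordinates on the segments [a, x], x < b, agree up to a positive factor and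
   so glue to an isomorphism onto [0, T) with T possibly infinite.  Uniqueness
   holds since isomorphisms between intervals of the real line are affine. *)

Require Import Defs.
From mathcomp Require Import ring lra.

Set Implicit Arguments.
Unset Strict Implicit.

Local Open Scope classical_set_scope.
Local Open Scope ring_scope.

(** * Auxiliary facts on weights and powers *)

Lemma assoc_weight_itv (R : realType) (p q : R) : 0 < p < 1 -> 0 < q < 1 ->
  0 < (1 - p) * q / (1 - p * q) < 1.
Proof.
move=> Hp Hq; have h : 0 < 1 - p * q by nra.
by apply/andP; split; [apply: divr_gt0 => //; nra | rewrite ltr_pdivrMr//; nra].
Qed.

Lemma exprn_lt (R : realType) (t e : R) : 0 <= t < 1 -> 0 < e ->
  exists n, t ^+ n < e.
Proof.
move=> /andP[t0 t1] e0.
have /cvgrPdist_lt/(_ e e0) [n _ /(_ n (leqnn n))] : t ^+ n @[n --> \oo] --> 0.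
  by apply: cvg_expr; rewrite ger0_norm.
rewrite /= sub0r normrN ger0_norm ?exprn_ge0// => h; by exists n.
Qed.

(** * Segments in an arbitrary convex algebra *)

Section ConvexAlgebra.
Variables (R : realType) (T : Type) (X : set T) (op : R -> T -> T -> T).
Hypothesis Hconv : convex_algebra X op.
Variables (x a : T).
Hypotheses (Xx : X x) (Xa : X a).
Implicit Types p q s t : R.

Local Notation phi t := (ext_op op t x a).

Lemma ext_op0 : phi 0 = a.
Proof. by rewrite /ext_op eq_sym oner_eq0 eqxx. Qed.

Lemma ext_op1 : phi 1 = x.
Proof. by rewrite /ext_op eqxx. Qed.

Lemma ext_op_in p : 0 < p < 1 -> phi p = op p x a.
Proof. by move=> Hp; rewrite /ext_op !ifF//; apply/negbTE; lra. Qed.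

Lemma ext_op_itv t : 0 <= t <= 1 -> [\/ t = 0, t = 1 | 0 < t < 1].
Proof.
move=> /andP[]; rewrite le_eqVlt => /orP[/eqP<- _|t0]; first by constructor 1.
rewrite le_eqVlt => /orP[/eqP->|t1]; first by constructor 2.
by constructor 3; apply/andP.
Qed.

Lemma ext_op_X t : 0 <= t <= 1 -> X (phi t).
Proof.
case: Hconv => Hcl _ _ _ /ext_op_itv[->|->|Ht].
- by rewrite ext_op0.
- by rewrite ext_op1.
- by rewrite ext_op_in//; exact: Hcl.
Qed.

Lemma op_ext_op_l p s : 0 < p < 1 -> 0 <= s <= 1 ->
  op p (phi s) a = phi (p * s).
Proof.
case: Hconv => Hcl Hid Hco Has Hp /ext_op_itv[->|->|Hs].
- by rewrite mulr0 ext_op0 Hid.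
- by rewrite mulr1 ext_op1 ext_op_in.
- rewrite !ext_op_in//; last by apply/andP; split; nra.
  by rewrite Has// Hid ?assoc_weight_itv// mulrC.
Qed.

Lemma op_ext_op_r p s : 0 < p < 1 -> 0 <= s <= 1 ->
  op p x (phi s) = phi (p + (1 - p) * s).
Proof.
case: Hconv => Hcl Hid Hco Has Hp /ext_op_itv[->|->|Hs].
- by rewrite mulr0 addr0 ext_op0 ext_op_in.
- by rewrite mulr1 addrC subrK ext_op1 Hid.
- have Hv : 0 < p + (1 - p) * s < 1 by apply/andP; split; nra.
  (* Associativity is used backwards: writing the left argument [x] on the right-hand side as a
     combination of [x] with itself of this weight splits off exactly the weight [p]. *)
  have Hu : 0 < p / (p + (1 - p) * s) < 1.
    apply/andP; split; first by apply: divr_gt0; lra.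
    by rewrite ltr_pdivrMr; nra.
  rewrite !ext_op_in//.
  rewrite -[X in _ = op _ X _](Hid (p / (p + (1 - p) * s)) x)// Has//.
  have -> : p / (p + (1 - p) * s) * (p + (1 - p) * s) = p.
    by rewrite divfK//; lra.
  congr (op _ _ (op _ _ _)); field; apply/andP; split; lra.
Qed.

(** Reassociating [op p (op t x a) (phi s)] puts [x] outermost with weight [t * p], which leaves one
    combination with [a] and then one with [x]. Hence [t |-> phi t] is a homomorphism from the real
    unit interval. *)
Lemma op_ext_op p s t : 0 < p < 1 -> 0 <= s <= 1 -> 0 <= t <= 1 ->
  op p (phi t) (phi s) = phi (p * t + (1 - p) * s).
Proof.
move=> Hp Hs Ht; have Xs := ext_op_X Hs; case: Hconv => Hcl Hid Hco Has.
have op_a q : 0 < q < 1 -> op q a (phi s) = phi ((1 - q) * s).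
  by move=> Hq; rewrite Hco// op_ext_op_l//; lra.
case/ext_op_itv: Ht => [->|->|Ht].
- by rewrite mulr0 add0r ext_op0 op_a.
- by rewrite mulr1 ext_op1 op_ext_op_r.
- have Htp : 0 < t * p < 1 by apply/andP; split; nra.
  have Hw := assoc_weight_itv Ht Hp.
  rewrite (ext_op_in Ht) Has// op_a// op_ext_op_r//.
    congr (ext_op _ _ _ _); field; lra.
  by apply/andP; split; nra.
Qed.

End ConvexAlgebra.

(** * Consequences of (MO), and the set of elements that eat 0 *)

Section MonotoneAlgebra.
Variables (R : realType) (op : R -> R -> R -> R).
Hypotheses (Hconv : convex_algebra `[0, 1] op) (HMO : MO op).
Implicit Types p q s t x y z a b : R.

Lemma unit_itvE (x : R) : `[0, 1]%classic x = (0 <= x <= 1) :> Prop.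
Proof. by rewrite /= in_itv. Qed.

Lemma op_idem p x : 0 < p < 1 -> 0 <= x <= 1 -> op p x x = x.
Proof. by case: Hconv => _ H _ _; have := H p x; rewrite !unit_itvE. Qed.

Lemma op_comm p x y : 0 < p < 1 -> 0 <= x <= 1 -> 0 <= y <= 1 ->
  op p x y = op (1 - p) y x.
Proof. by case: Hconv => _ _ H _; have := H p x y; rewrite !unit_itvE. Qed.

Lemma op_le p x x' y y' : 0 < p < 1 -> 0 <= x -> x <= x' -> x' <= 1 ->
  0 <= y -> y <= y' -> y' <= 1 -> op p x y <= op p x' y'.
Proof.
move=> Hp x0 xx' x1 y0 yy' y1; apply: (@le_trans _ _ (op p x' y)).
  by apply: HMO => //; lra.
rewrite [op p x' y]op_comm ?[op p x' y']op_comm//; [|lra..].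
by apply: HMO => //; lra.
Qed.

Lemma op_between p x y a b : 0 < p < 1 -> 0 <= a -> b <= 1 ->
  a <= x <= b -> a <= y <= b -> a <= op p x y <= b.
Proof.
move=> Hp a0 b1 /andP[ax xb] /andP[ay yb].
have aa : op p a a = a by apply: op_idem => //; lra.
have bb : op p b b = b by apply: op_idem => //; lra.
by rewrite -{1}aa -{1}bb !op_le//; lra.
Qed.

Lemma ext_op_between t x a : 0 <= t <= 1 -> 0 <= a -> a <= x -> x <= 1 ->
  a <= ext_op op t x a <= x.
Proof.
move=> /ext_op_itv[->|->|Ht] a0 ax x1.
- by rewrite ext_op0 lexx ax.
- by rewrite ext_op1 lexx ax.
- by rewrite ext_op_in// op_between// lexx ax.
Qed.

(** For [0 < s < t], the point at [s] is the combination of the point at [t] with [a] of weight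
    [s / t], so it lies between these two. *)
Lemma ext_op_le s t x a : 0 <= s -> s <= t -> t <= 1 ->
  0 <= a -> a <= x -> x <= 1 -> ext_op op s x a <= ext_op op t x a.
Proof.
move=> s0; rewrite le_eqVlt => /orP[/eqP->//|st] t1 a0 ax x1.
have Ht : 0 <= t <= 1 by lra.
have /andP[at_ tx] := ext_op_between Ht a0 ax x1.
move: s0; rewrite le_eqVlt => /orP[/eqP<-|s0]; first by rewrite ext_op0.
have Hst : 0 < s / t < 1.
  by apply/andP; split; [apply: divr_gt0; lra | rewrite ltr_pdivrMr; lra].
have -> : s = s / t * t by rewrite divfK//; lra.
rewrite -(op_ext_op_l Hconv) ?unit_itvE//; [|lra..].
have /andP[] // : a <= op (s / t) (ext_op op t x a) a <= ext_op op t x a.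
by apply: op_between; rewrite ?lexx ?at_//; lra.
Qed.

Lemma EsetP y : Eset op y <->
  0 <= y <= 1 /\ (forall p, 0 < p < 1 -> op p y 0 = y).
Proof.
split=> -[Hy H]; split => // p Hp.
  by have := H p; rewrite ext_op_in//; apply; lra.
have [->|p1] := eqVneq p 1; first by rewrite ext_op1.
have {}p1 : p < 1 by rewrite lt_neqAle p1; case/andP: Hp.
by rewrite ext_op_in ?H//; lra.
Qed.

Lemma Eset_ge0 y : Eset op y -> 0 <= y.
Proof. by case=> /andP[]. Qed.

(** Monotonicity squeezes: [a = op p a 0 <= op p a z <= a]. *)
Lemma Eset_op a p z : Eset op a -> 0 < p < 1 -> 0 <= z -> z <= a ->
  op p a z = a.
Proof.
move=> /EsetP[/andP[a0 a1] H] Hp z0 za; apply/eqP; rewrite eq_le.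
have /andP[_ ->] : 0 <= op p a z <= a by apply: op_between => //; lra.
by rewrite -{1}(H p Hp) op_le//; lra.
Qed.

Lemma Eset0 : Eset op 0.
Proof. by apply/EsetP; split; [lra|move=> p Hp; apply: op_idem => //; lra]. Qed.

(** The supremum itself eats 0: each [y] in the set satisfies
    [y = op p y 0 <= op p (sup (Eset op)) 0], so the right-hand side is an upper bound. *)
Lemma Eset_max : exists m, is_max (Eset op) m.
Proof.
have Eub : ubound (Eset op) 1 by move=> y [] /andP[].
have Esup y : Eset op y -> y <= sup (Eset op).
  by apply: ub_le_sup; exists 1.
have s1 : sup (Eset op) <= 1 by apply: ge_sup => //; exists 0; exact: Eset0.
have s0 := Esup _ Eset0.
exists (sup (Eset op)); split => //.
apply/EsetP; split; [lra|move=> p Hp]; apply/eqP; rewrite eq_le.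
have /andP[_ ->] : 0 <= op p (sup (Eset op)) 0 <= sup (Eset op).
  by apply: op_between => //; lra.
apply: ge_sup; [by exists 0; exact: Eset0|move=> y Ey].
have := Esup _ Ey; case/EsetP: Ey => Hy yE ys.
by rewrite -{1}(yE p Hp) op_le//; lra.
Qed.

(* If [op t y 0 = y] for one weight [t], then also for the weights [t ^+ n],
   hence by monotonicity for all weights. *)
Lemma op0_fixed_Eset y t : 0 <= y <= 1 -> 0 < t < 1 -> op t y 0 = y ->
  Eset op y.
Proof.
move=> Hy Ht yE; apply/EsetP; split => // p Hp.
have zero1 : 0 <= (0 : R) <= 1 by lra.
have Hn n : ext_op op (t ^+ n) y 0 = y.
  elim: n => [|n IH]; first by rewrite expr0 ext_op1.
  have tn : 0 <= t ^+ n <= 1.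
    by rewrite exprn_ge0 ?exprn_ile1//; lra.
  by rewrite exprS -(op_ext_op_l Hconv) ?unit_itvE// IH.
have [n tnp] : exists n, t ^+ n < p by apply: exprn_lt; lra.
apply/eqP; rewrite eq_le; apply/andP; split.
  by have /andP[] : 0 <= op p y 0 <= y by apply: op_between => //; lra.
rewrite -{1}(Hn n) -(ext_op_in op y 0 Hp).
by apply: ext_op_le; rewrite ?exprn_ge0//; lra.
Qed.

End MonotoneAlgebra.

(** * Forms of (LC) and (UC) free of limits *)

Section Limits.
Variables (R : realType) (op : R -> R -> R -> R).
Implicit Types p x y z c : R.

Lemma LC_witness x y z : LC op -> 0 <= x -> x <= y -> y <= 1 -> z < y ->
  exists2 p, 0 < p < 1 & z < op p y x.
Proof.
move=> HLC x0 xy y1 zy.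
have : (y%:E <= limf_einf (fun p : R => (op p y x)%:E) 1^'-)%E.
  by apply: HLC => //; lra.
have zyE : (z%:E < y%:E)%E by rewrite lte_fin.
rewrite limf_einfE => /(lt_le_trans zyE) /ereal_sup_gt [_ [V V1 <-]] zV.
have [p [Vp p0 p1]] : exists p, [/\ V p, 0 < p & p < 1].
  apply: (@filter_ex _ 1^'-); near=> p; split; near: p => //.
    exact: nbhs_left_gt.
  exact: nbhs_left_lt.
exists p; first exact/andP.
rewrite -lte_fin; apply: lt_le_trans zV _.
by apply: ereal_inf_lbound; exists p.
Unshelve. all: by end_near. Qed.

(** Every right neighbourhood of 0 contains a shift [e] that keeps both arguments in the unit
    interval, so a lower bound at such shifts bounds the upper limit from below. *)
Lemma UC_lower_bound x y p c : UC op ->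
  0 <= x < 1 -> 0 <= y < 1 -> 0 < p < 1 ->
  (forall e, 0 < e -> x + e <= 1 -> y + e <= 1 -> c <= op p (x + e) (y + e)) ->
  c <= op p x y.
Proof.
move=> HUC Hx Hy Hp Hc; rewrite -lee_fin; apply: le_trans (HUC _ _ _ Hx Hy Hp).
rewrite limf_esupE; apply: le_ereal_inf_tmp => _ [V V0 <-].
have [e [Ve e0 ex ey]] :
    exists e, [/\ V e, 0 < e, x + e <= 1 & y + e <= 1].
  apply: (@filter_ex _ 0^'+); near=> e; split; near: e => //.
  - exact: nbhs_right_gt.
  - by near=> e; rewrite -lerBrDl; near: e; apply: nbhs_right_le; lra.
  - by near=> e; rewrite -lerBrDl; near: e; apply: nbhs_right_le; lra.
apply: le_ereal_sup_tmp; exists (op p (x + e) (y + e))%:E; first by exists e.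
by rewrite lee_fin Hc.
Unshelve. all: by end_near. Qed.

End Limits.

(** * The chord from [a] to [x]: strict monotonicity, continuity, surjectivity *)

Section Chord.
Variables (R : realType) (op : R -> R -> R -> R).
Hypotheses (Hconv : convex_algebra `[0, 1] op).
Hypotheses (HMO : MO op) (HUC : UC op) (HLC : LC op).
Variables (a x : R).
Hypotheses (Ea : Eset op a) (Hax : a < x) (Hx1 : x <= 1).
Hypothesis (noE : forall y, a < y -> y <= x -> ~ Eset op y).
Implicit Types p q s t y z : R.

Local Notation phi t := (ext_op op t x a).

Let chord_ends : [/\ 0 <= a, a < x & x <= 1].
Proof. by split => //; exact: Eset_ge0 Ea. Qed.

Lemma op0_lt y p : a < y -> y <= x -> 0 < p < 1 -> op p y 0 < y.
Proof.
have [a0 ax x1] := chord_ends.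
move=> ay yx Hp; rewrite lt_neqAle; apply/andP; split.
  apply/eqP => yE; apply: (noE ay yx).
  by apply: (op0_fixed_Eset Hconv HMO _ Hp yE); lra.
by have /andP[] : 0 <= op p y 0 <= y by apply: op_between => //; lra.
Qed.

(* Since [a] eats [0], [op p y a = op q (op r y a) 0] whenever [p = r * q]. *)
Lemma op_eater_lt y p : a < y -> y <= x -> 0 < p < 1 -> op p y a < y.
Proof.
have [a0 ax x1] := chord_ends.
move=> ay yx Hp; pose r := (1 + p) / 2; pose q := p / r.
have Hr : 0 < r < 1 by rewrite /r; lra.
have Hq : 0 < q < 1.
  apply/andP; split; first by apply: divr_gt0; lra.
  by rewrite ltr_pdivrMr /r; lra.
have <- : op q (op r y a) 0 = op p y a.
  case: Hconv => _ _ _ ->//; rewrite ?unit_itvE; [|lra..].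
  rewrite (Eset_op Hconv HMO Ea) //; last exact: assoc_weight_itv.
  by rewrite [r * _]mulrC divfK//; lra.
apply: le_lt_trans (op0_lt ay yx Hq).
have /andP[ra ry] : a <= op r y a <= y by apply: op_between => //; lra.
by apply: op_le => //; lra.
Qed.

Lemma op_eater_gt p : 0 < p < 1 -> a < op p x a.
Proof.
have [a0 ax x1] := chord_ends.
move=> Hp; rewrite lt_neqAle eq_sym; apply/andP; split; last first.
  by have /andP[] : a <= op p x a <= x by apply: op_between => //; lra.
apply/eqP => pE.
have Hn n : 0 <= (1 - p) ^+ n <= 1 by rewrite exprn_ge0 ?exprn_ile1//; lra.
(* [phi v = a] implies [phi (p + (1 - p) * v) = op p x (phi v) = a]. *)
have phiE n : phi (1 - (1 - p) ^+ n.+1) = a.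
  elim: n => [|n IH]; first by rewrite expr1 subKr ext_op_in.
  have := @op_ext_op_r _ _ _ _ Hconv x a _ _ p (1 - (1 - p) ^+ n.+1) Hp.
  rewrite !unit_itvE IH pE => aE; rewrite [RHS]aE; [|have := Hn n.+1; lra..].
  by congr (ext_op _ _ _ _); rewrite exprS; ring.
(* (LC) gives a weight [q] with [op q x a > a]. Since [phi] takes the value [a] at weights beyond
   [q], monotonicity gives the contrary bound. *)
have [q Hq aq] := LC_witness HLC a0 (ltW ax) x1 ax.
have [n nq] : exists n, (1 - p) ^+ n < 1 - q by apply: exprn_lt; lra.
have : op q x a <= a.
  rewrite -{2}(phiE n) -(ext_op_in op x a Hq); apply: ext_op_le => //; try lra.
    have : (1 - p) ^+ n.+1 <= (1 - p) ^+ n.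
      by rewrite exprS ler_piMl//; have := Hn n; lra.
    lra.
  by have := Hn n.+1; lra.
lra.
Qed.

Lemma chord_gt t : 0 < t -> t <= 1 -> a < phi t.
Proof.
have [a0 ax x1] := chord_ends.
move=> t0; rewrite le_eqVlt => /orP[/eqP->|t1]; first by rewrite ext_op1.
by rewrite ext_op_in ?op_eater_gt ?t0.
Qed.

Lemma chord_between t : 0 <= t <= 1 -> a <= phi t <= x.
Proof.
have [a0 ax x1] := chord_ends.
by move=> Ht; apply: ext_op_between => //; exact: ltW.
Qed.

Lemma op_chord p s t : 0 < p < 1 -> 0 <= s <= 1 -> 0 <= t <= 1 ->
  op p (phi t) (phi s) = phi (p * t + (1 - p) * s).
Proof.
have [a0 ax x1] := chord_ends.
by move=> *; apply: (op_ext_op Hconv); rewrite ?unit_itvE//; lra.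
Qed.

Lemma op_chord_l p s : 0 < p < 1 -> 0 <= s <= 1 -> op p (phi s) a = phi (p * s).
Proof.
have [a0 ax x1] := chord_ends.
by move=> *; apply: (op_ext_op_l Hconv); rewrite ?unit_itvE//; lra.
Qed.

(** For [s > 0], [phi s] is the combination of [phi t] with [a] of weight [s / t], and combining
    with [a] strictly decreases every point of [(a, x]]. *)
Lemma chord_lt s t : 0 <= s -> s < t -> t <= 1 -> phi s < phi t.
Proof.
have [a0 ax x1] := chord_ends.
rewrite le_eqVlt => /orP[/eqP<-|s0] st t1; first by rewrite ext_op0 chord_gt.
have Hst : 0 < s / t < 1.
  by apply/andP; split; [apply: divr_gt0; lra | rewrite ltr_pdivrMr; lra].
have {1}-> : s = s / t * t by rewrite divfK//; lra.
have Ht : 0 <= t <= 1 by lra.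
rewrite -op_chord_l//; apply: op_eater_lt => //; last first.
  by case/andP: (chord_between Ht).
by apply: chord_gt; lra.
Qed.

Lemma chord_inj s t : 0 <= s <= 1 -> 0 <= t <= 1 -> phi s = phi t -> s = t.
Proof.
move=> Hs Ht st; case: (ltgtP s t) => // h.
  by have := @chord_lt s t; rewrite st ltxx => H; have: false by apply: H; lra.
by have := @chord_lt t s; rewrite st ltxx => H; have: false by apply: H; lra.
Qed.

Lemma chord_le s t : 0 <= s -> s <= t -> t <= 1 -> phi s <= phi t.
Proof.
have [a0 ax x1] := chord_ends.
by move=> *; apply: ext_op_le => //; lra.
Qed.

(** If [phi t > c], then (LC) gives a weight [p] with [c < op p (phi t) a = phi (p * t)], although
    [p * t < t]. The bound [a <= c] covers [t = 0]. *)
Lemma chord_left_cont t c : 0 <= t <= 1 ->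
  (forall s, 0 <= s -> s < t -> phi s <= c) -> a <= c -> phi t <= c.
Proof.
have [a0 ax x1] := chord_ends.
move=> Ht Hc ac; rewrite leNgt; apply/negP => ct.
have t0 : 0 < t.
  rewrite lt_neqAle; case/andP: Ht => -> _; rewrite andbT; apply/eqP => t0.
  by move: ct; rewrite -t0 ext_op0; lra.
have /andP[at_ tx] := chord_between Ht.
have [p Hp] := LC_witness HLC a0 at_ (le_trans tx x1) ct.
rewrite op_chord_l// => cp.
have : phi (p * t) <= c by apply: Hc; nra.
lra.
Qed.

(* At a jump of [phi] at [t], let [d] be the right limit.  If [t > 0], then
   [op p d a <= op p (phi s) a = phi (p * s) <= phi t] for any [s > t] with
   [p * s <= t], contradicting (LC).  If [t = 0], then (UC) at [(d, a)] yields
   [d <= op p d a], which is impossible. *)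
Lemma chord_right_cont t c : 0 <= t < 1 -> c <= x ->
  (forall s, t < s -> s <= 1 -> c <= phi s) -> c <= phi t.
Proof.
have [a0 ax x1] := chord_ends.
move=> Ht cx Hc; rewrite leNgt; apply/negP => tc.
pose S := [set phi s | s in [set s | t < s /\ s <= 1]].
have S0 : S !=set0 by exists (phi 1), 1 => //=; lra.
have Sc : lbound S c by move=> _ [s [ts s1] <-]; exact: Hc.
pose d := inf S.
have cd : c <= d by exact: lb_le_inf.
have dphi s : t < s -> s <= 1 -> d <= phi s.
  by move=> ts s1; apply: ge_inf; [by exists c|by exists s].
have Ht1 : 0 <= t <= 1 by lra.
have /andP[at_ _] := chord_between Ht1.
have dx : d < x.
  apply: (@le_lt_trans _ _ (phi ((1 + t) / 2))); first by apply: dphi; lra.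
  by rewrite -[ltRHS](ext_op1 op x a); apply: chord_lt; lra.
move: (Ht) => /andP[]; rewrite le_eqVlt => /orP[/eqP t0|t0] t1.
  have [h Hh] : exists h : R, 0 < h < 1 by exists (1 / 2); lra.
  (* For each shift [e] some [s > 0] has [phi s < d + e]. Then [op h (phi s) a = phi (h * s)] is at
     least [d], because [h * s] is still positive. *)
  have : d <= op h d a.
    apply: UC_lower_bound => //; try lra.
    move=> e e0 de ae.
    have [|_ [s [ts s1] <-] se] := inf_adherent e0 (_ : has_inf S).
      by split => //; exists c.
    have Hs : 0 <= s <= 1 by lra.
    have /andP[as_ _] := chord_between Hs.
    apply: (@le_trans _ _ (op h (phi s) a)); last by apply: op_le => //; lra.
    by rewrite op_chord_l//; apply: dphi; nra.
  have : op h d a < d by apply: op_eater_lt => //; lra.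
  lra.
have ad : a <= d by lra.
have d1 : d <= 1 by lra.
have [p Hp tp] := LC_witness HLC a0 ad d1 (lt_le_trans tc cd).
(* Since [p < 1], [t / p] exceeds [t]; the cap at 1 keeps [s'] a weight and preserves
   [p * s' <= t]. *)
pose s' := Num.min 1 (t / p).
have ts' : t < s' by rewrite lt_min t1 ltr_pdivlMr//; nra.
have ps' : p * s' <= t.
  by rewrite mulrC -ler_pdivlMr ?ge_min ?lexx ?orbT//; lra.
have s'1 : s' <= 1 by rewrite ge_min lexx.
have : op p d a <= op p (phi s') a.
  have Hs : 0 <= s' <= 1 by lra.
  have /andP[_ sx] := chord_between Hs.
  by apply: op_le => //; [lra|exact: dphi|lra..].
rewrite op_chord_l//; last lra.
have : phi (p * s') <= phi t by apply: chord_le; nra.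
lra.
Qed.

Lemma chord_surj y : a <= y -> y <= x -> exists2 t, 0 <= t <= 1 & phi t = y.
Proof.
have [a0 ax x1] := chord_ends.
move=> ay; rewrite le_eqVlt => /orP[/eqP->|yx].
  by exists 1; rewrite ?ext_op1//; lra.
(* The preimage is [sup S]: left continuity gives [phi (sup S) <= y], right continuity the
   converse. *)
pose S := [set t | 0 <= t <= 1 /\ phi t <= y].
have S0 : S 0 by split; [lra|rewrite ext_op0].
have Sub : ubound S 1 by move=> t [/andP[]].
have St t : S t -> t <= sup S by apply: ub_le_sup; exists 1.
have s0 := St _ S0.
have s1 : sup S <= 1 by apply: ge_sup => //; exists 0.
have Hs : 0 <= sup S <= 1 by rewrite s0.
have sy : phi (sup S) <= y.
  apply: chord_left_cont => // s s0' sS.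
  have [||t [Ht ty] st] := @sup_adherent _ S (sup S - s).
    by rewrite subr_gt0.
    by split; [exists 0|exists 1].
  by apply: le_trans ty; apply: chord_le; lra.
exists (sup S) => //; apply/eqP; rewrite eq_le sy /=.
have yx' := ltW yx; apply: chord_right_cont => //.
  rewrite s0 lt_neqAle s1 andbT; apply/eqP => sE.
  by move: sy; rewrite sE ext_op1; lra.
move=> s sS s1'; rewrite leNgt; apply/negP => ys.
have : s <= sup S by apply: St; split; [lra|exact: ltW].
lra.
Qed.

End Chord.

(** * The coordinate on [[a, x]], inverse to the chord *)

Definition eater_gap (R : realType) (op : R -> R -> R -> R) (a x : R) : Prop :=
  [/\ a < x, x <= 1 & forall y, a < y -> y <= x -> ~ Eset op y].

(** The default 0 is never taken when [y] lies in [[a, x]] and the chord is onto. *)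
Definition coord (R : realType) (op : R -> R -> R -> R) (a x y : R) : R :=
  xget 0 [set t | 0 <= t <= 1 /\ ext_op op t x a = y].

Section Coordinate.
Variables (R : realType) (op : R -> R -> R -> R).
Hypotheses (Hconv : convex_algebra `[0, 1] op).
Hypotheses (HMO : MO op) (HUC : UC op) (HLC : LC op).
Variables (a : R).
Hypothesis (Ea : Eset op a).
Implicit Types p t w x y z : R.

Local Notation coord := (coord op a).
Local Notation gap := (eater_gap op a).

Lemma eater_gapW x y : gap x -> a < y -> y <= x -> gap y.
Proof.
move=> [ax x1 noE] ay yx; split => //; first exact: le_trans x1.
by move=> z az zy; apply: noE => //; exact: le_trans yx.
Qed.

Lemma coordP x y : gap x -> a <= y -> y <= x ->
  0 <= coord x y <= 1 /\ ext_op op (coord x y) x a = y.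
Proof.
move=> [ax x1 noE] ay yx; rewrite /coord; case: xgetP => [t _ //|H].
have [t Ht tE] := chord_surj Hconv HMO HUC HLC Ea ax x1 noE ay yx.
by case: (H t).
Qed.

Lemma coordK x t : gap x -> 0 <= t <= 1 -> coord x (ext_op op t x a) = t.
Proof.
move=> gx Ht; have [ax x1 noE] := gx.
have /andP[ay yx] := chord_between Hconv HMO Ea ax x1 Ht.
have [Hc cE] := coordP gx ay yx.
exact: (chord_inj Hconv HMO HLC Ea ax x1 noE).
Qed.

Lemma coord_left x : gap x -> coord x a = 0.
Proof.
by move=> gx; have := @coordK x 0 gx; rewrite ext_op0 lexx ler01; exact.
Qed.

Lemma coord_right x : gap x -> coord x x = 1.
Proof.
by move=> gx; have := @coordK x 1 gx; rewrite ext_op1 lexx ler01; exact.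
Qed.

Lemma coord_op x p y z : gap x -> 0 < p < 1 -> a <= y <= x -> a <= z <= x ->
  coord x (op p y z) = p * coord x y + (1 - p) * coord x z.
Proof.
move=> gx Hp /andP[ay yx] /andP[az zx]; have [ax x1 _] := gx.
have [Hy yE] := coordP gx ay yx; have [Hz zE] := coordP gx az zx.
rewrite -{1}yE -{1}zE (op_chord Hconv Ea ax x1)// coordK//.
by apply/andP; split; nra.
Qed.

Lemma coord_lt x y z : gap x -> a <= y -> y < z -> z <= x ->
  coord x y < coord x z.
Proof.
move=> gx ay yz zx; have [ax x1 _] := gx.
have [/andP[y0 y1] yE] := coordP gx ay (ltW (lt_le_trans yz zx)).
have [/andP[z0 z1] zE] := coordP gx (le_trans ay (ltW yz)) zx.
rewrite ltNge; apply/negP => zy.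
have := chord_le Hconv HMO Ea ax x1 z0 zy y1.
by rewrite yE zE leNgt yz.
Qed.

(** The chord to [y] is an initial piece of the chord to [x], run at speed [coord x y]. Thus
    changing the right end only rescales the coordinate, which is what permits gluing. *)
Lemma coord_mul x y z : gap x -> a < y -> y <= x -> a <= z -> z <= y ->
  coord x z = coord x y * coord y z.
Proof.
move=> gx ay yx az zy; have [ax x1 _] := gx; have gy := eater_gapW gx ay yx.
have [Hy yE] := coordP gx (ltW ay) yx.
have [Hz zE] := coordP gy az zy.
have a1 : 0 <= a <= 1 by have := Eset_ge0 Ea; lra.
have x01 : 0 <= x <= 1 by lra.
have {1}-> : z = ext_op op (coord x y * coord y z) x a.
  case/ext_op_itv: (Hz) => Hz'.
  - by move: zE; rewrite Hz' mulr0 !ext_op0.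
  - by move: zE; rewrite Hz' mulr1 yE ext_op1.
  - rewrite mulrC -(op_ext_op_l Hconv) ?unit_itvE// yE.
    by rewrite -(ext_op_in op y a Hz') zE.
by rewrite coordK//; apply/andP; split; nra.
Qed.

End Coordinate.

(** * Rigidity of isomorphisms onto real intervals *)

Section AffineIsomorphisms.
Variables (R : realType) (T : Type) (X : set T) (op : R -> T -> T -> T).
Hypothesis Xcl : op_closed X op.
Implicit Types (Y Z : set R) (f h : T -> R).

(* An isomorphism is determined by its values at two points, as [y] lying
   between [u] and [w] in the coordinate [f] forces [y = op p w u]. *)
Lemma isomorphism_affine Y Z f h u w y :
  isomorphism X op Y (@plus_op R) f -> isomorphism X op Z (@plus_op R) h ->
  X u -> X w -> X y -> f u <= f y <= f w ->
  (f w - f u) * (h y - h u) = (f y - f u) * (h w - h u).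
Proof.
move=> [[_ finj _] fop] [_ hop] Xu Xw Xy /andP[].
have {}finj s t : X s -> X t -> f s = f t -> s = t.
  by move=> Xs Xt; apply: finj; rewrite inE.
rewrite le_eqVlt => /orP[/eqP/(finj _ _ Xu Xy)<- _|uy].
  by rewrite !subrr mulr0 mul0r.
rewrite le_eqVlt => /orP[/eqP/(finj _ _ Xy Xw)->//|yw].
have uw := lt_trans uy yw.
pose p := (f y - f u) / (f w - f u).
have pE : p * (f w - f u) = f y - f u by rewrite divfK//; lra.
have Hp : 0 < p < 1.
  by apply/andP; split; [apply: divr_gt0; lra | rewrite ltr_pdivrMr; lra].
have -> : y = op p w u.
  apply: finj => //; first exact: Xcl.
  by rewrite fop// /plus_op; lra.
by rewrite hop// fop// /plus_op; ring.
Qed.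

Lemma isomorphism_unit_itv f h :
  isomorphism X op `[0, 1] (@plus_op R) f ->
  isomorphism X op `[0, 1] (@plus_op R) h ->
  eq_on X h f \/ eq_on X h (fun y => 1 - f y).
Proof.
move=> fiso hiso; have [[ffun _ fsurj] _] := fiso.
have [[hfun _ hsurj] _] := hiso.
have f01 y : X y -> 0 <= f y <= 1 by move/ffun; rewrite /= in_itv.
have h01 y : X y -> 0 <= h y <= 1 by move/hfun; rewrite /= in_itv.
have one01 : `[0, 1]%classic (1 : R) by rewrite /= in_itv /= ler01 lexx.
have zero01 : `[0, 1]%classic (0 : R) by rewrite /= in_itv /= ler01 lexx.
have [u Xu fu] := fsurj _ zero01; have [w Xw fw] := fsurj _ one01.
have hE y : X y -> h y = (1 - f y) * h u + f y * h w.
  move=> Xy; have := isomorphism_affine fiso hiso Xu Xw Xy.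
  by rewrite fu fw => /(_ (f01 y Xy)) E; lra.
have [y0 Xy0 hy0] := hsurj _ zero01; have [y1 Xy1 hy1] := hsurj _ one01.
have := hE _ Xy0; have := hE _ Xy1; rewrite hy0 hy1 => E1 E0.
have /andP[p0 p1] := f01 _ Xy0; have /andP[q0 q1] := f01 _ Xy1.
have /andP[hu0 hu1] := h01 _ Xu; have /andP[hw0 hw1] := h01 _ Xw.
(* The value 0 of [h] is a convex combination of the nonnegative [h u] and [h w], so one of them
   vanishes; likewise for the value 1. *)
have H0 : h u = 0 \/ h w = 0.
  have [->|/eqP hu] := eqVneq (h u) 0; [by left|right].
  have : h u * h w = 0 by nra.
  by move/eqP; rewrite mulf_eq0 => /orP[] /eqP.
have H1 : h u = 1 \/ h w = 1.
  have [->|/eqP hu] := eqVneq (h u) 1; [by left|right].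
  have : (1 - h u) * (1 - h w) = 0 by nra.
  by move/eqP; rewrite mulf_eq0 => /orP[] /eqP; lra.
case: H0 H1 => [hu|hw] [hu'|hw']; try lra.
- by left=> y Xy; rewrite hE// hu hw'; ring.
- by right=> y Xy; rewrite hE// hu' hw; ring.
Qed.

End AffineIsomorphisms.

(** * Isomorphisms onto [[0, 1)] and [[0, +oo)] *)

Section HalfOpen.
Variable (R : realType).
Implicit Types (x y c : R) (tau : \bar R).

Lemma half_open1E x : half_open 1%:E x = (0 <= x < 1) :> Prop.
Proof.
by rewrite /half_open /= lte_fin; apply/propext; split => [[-> ->]//|/andP].
Qed.

Lemma half_openyE x : half_open +oo%E x = (0 <= x) :> Prop.
Proof.
by rewrite /half_open /= ltry; apply/propext; split => [[]|].
Qed.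

Lemma half_open_no_max tau x : tau = 1%:E \/ tau = +oo%E ->
  half_open tau x -> exists2 y, x < y & half_open tau y.
Proof.
case=> ->; rewrite ?half_open1E ?half_openyE => Hx.
  by exists ((x + 1) / 2); rewrite ?half_open1E; lra.
by exists (x + 1); rewrite ?half_openyE; lra.
Qed.

Lemma half_open0 tau : tau = 1%:E \/ tau = +oo%E -> half_open tau 0.
Proof. by case=> ->; rewrite ?half_open1E ?half_openyE; lra. Qed.

Lemma isomorphism_half_open_scale (T : Type) (X : set T) (op : R -> T -> T -> T)
    (f h : T -> R) (tau tau' : \bar R) : op_closed X op ->
  tau = 1%:E \/ tau = +oo%E -> tau' = 1%:E \/ tau' = +oo%E ->
  isomorphism X op (half_open tau) (@plus_op R) f ->
  isomorphism X op (half_open tau') (@plus_op R) h ->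
  exists2 k : R, 0 < k & forall y : T, X y -> h y = k * f y.
Proof.
move=> Xcl Ht Ht' fiso hiso; have [[ffun _ fsurj] _] := fiso.
have [[hfun _ hsurj] _] := hiso.
have f0 (y : T) : X y -> 0 <= f y by case/ffun.
have h0 (y : T) : X y -> 0 <= h y by case/hfun.
have [c c0 tc] := half_open_no_max Ht (half_open0 Ht).
have [u Xu fu] := fsurj _ (half_open0 Ht); have [w Xw fw] := fsurj _ tc.
have [d ud td] := half_open_no_max Ht' (hfun _ Xu).
have [y1 Xy1 hy1] := hsurj _ td; have [y0 Xy0 hy0] := hsurj _ (half_open0 Ht').
clear Ht Ht'.
pose k := (h w - h u) / c.
have kE : k * c = h w - h u by rewrite divfK//; lra.
(* The affine relation needs the third point in the middle: [y] between [u] and [w], or else [w]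
   between [u] and [y]. *)
have hE (y : T) : X y -> h y = h u + k * f y.
  move=> Xy; have := f0 _ Xy; have [yc|cy] := leP (f y) c => fy0.
    have := isomorphism_affine Xcl fiso hiso Xu Xw Xy.
    rewrite fu fw fy0 yc => /(_ isT) E.
    have : c * (h y - h u - k * f y) = 0 by nra.
    by move/eqP; rewrite mulf_eq0 => /orP[] /eqP; lra.
  have := isomorphism_affine Xcl fiso hiso Xu Xy Xw.
  rewrite fu fw (ltW c0) (ltW cy) => /(_ isT) E.
  have : c * (h y - h u - k * f y) = 0 by nra.
  by move/eqP; rewrite mulf_eq0 => /orP[] /eqP; lra.
(* As the target of [h] has no maximum, [h] exceeds [h u] at [y1], which forces a positive slope.
   Then [h u] is the least value of [h], hence 0. *)
have k0 : 0 < k by have := hE _ Xy1; have := f0 _ Xy1; nra.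
have hu : h u = 0.
  by have := hE _ Xy0; have := f0 _ Xy0; have := h0 _ Xu; nra.
by exists k => // y Xy; rewrite hE// hu add0r.
Qed.

End HalfOpen.

(** * Subalgebras, and the isomorphism on [[m, 1]] *)

Section MainParts.
Variables (R : realType) (op : R -> R -> R -> R).
Hypotheses (Hconv : convex_algebra `[0, 1] op).
Hypotheses (HMO : MO op) (HUC : UC op) (HLC : LC op).
Implicit Types a b m p t w x y z : R.

Lemma subalgebra_cc m : 0 <= m -> subalgebra `[0, 1] op `[m, 1].
Proof.
move=> m0; split=> [y|p y z Hp]; rewrite /= !in_itv /=; first by lra.
by move=> *; apply: op_between => //; lra.
Qed.

Lemma subalgebra_co a b : 0 <= a -> b <= 1 ->
  subalgebra `[0, 1] op (`[a, b[%classic).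
Proof.
move=> a0 b1; split=> [y|p y z Hp]; rewrite /= !in_itv /=; first by lra.
(* Bounding by the larger argument rather than by [b] keeps the upper bound strict. *)
move=> /andP[ay yb] /andP[az zb]; pose w := Num.max y z.
have wb : w < b by rewrite gt_max yb.
have /andP[-> ow] : a <= op p y z <= w.
  by apply: op_between; rewrite ?ay ?az ?le_max ?lexx ?orbT //; lra.
exact: le_lt_trans ow wb.
Qed.

Lemma coord_isomorphism m : Eset op m -> eater_gap op m 1 ->
  isomorphism `[m, 1] op `[0, 1] (@plus_op R) (coord op m 1).
Proof.
move=> Em g1; have [m1 _ _] := g1; split.
  split.
  - move=> y; rewrite /= !in_itv /= => /andP[my y1].
    by have [] := coordP Hconv HMO HUC HLC Em g1 my y1.
  - move=> y z; rewrite !inE /= !in_itv /= => /andP[my y1] /andP[mz z1] yz.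
    have [_ <-] := coordP Hconv HMO HUC HLC Em g1 my y1.
    by have [_ <-] := coordP Hconv HMO HUC HLC Em g1 mz z1; rewrite yz.
  - move=> t; rewrite /= in_itv /= => Ht; exists (ext_op op t 1 m).
      by rewrite /= in_itv /=; apply: chord_between.
    exact: coordK.
move=> p y z Hp; rewrite /= !in_itv /= => Hy Hz.
exact: coord_op.
Qed.

Lemma coord_increasing m : Eset op m -> eater_gap op m 1 ->
  increasing_on `[m, 1] (coord op m 1).
Proof.
move=> Em g1 y z; rewrite /= !in_itv /= => /andP[my _] /andP[_ z1] yz.
exact: coord_lt.
Qed.

(** * Gluing the coordinates on [[a, b)] *)

Section HalfOpenGap.
Variables (a b : R).
Hypotheses (Ea : Eset op a) (ab : a < b).
Hypothesis gap : forall x, a < x -> x < b -> eater_gap op a x.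

Let x0 := (a + b) / 2.
Let x0_itv : a < x0 < b. Proof. by have ab_ := ab; rewrite /x0; lra. Qed.

(* The coordinate of [y] in the scale where [a] is at [0] and the midpoint
   [x0] of [a, b] is at [1]. *)
Definition scale y : R :=
  let w := Num.max y ((a + b) / 2) in
  coord op a w y / coord op a w ((a + b) / 2).

(** Independence of the right end: passing from [Num.max y x0] to [w] multiplies numerator and
    denominator of [scale y] by the same factor. *)
Lemma scaleE w y : x0 <= w -> w < b -> a <= y -> y <= w ->
  [/\ eater_gap op a w, 0 < coord op a w x0 &
      coord op a w y = scale y * coord op a w x0].
Proof.
have /andP[ax0 x0b] := x0_itv; move=> x0w wb ay yw.
have pos v : x0 <= v -> v < b -> 0 < coord op a v x0.
  move=> x0v vb; have gv := gap (lt_le_trans ax0 x0v) vb.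
  by rewrite -(coord_left Hconv HMO HUC HLC Ea gv); apply: coord_lt.
have gw := gap (lt_le_trans ax0 x0w) wb; split => //; first exact: pos.
rewrite /scale -/x0; set v := Num.max y x0.
have yv : y <= v by rewrite le_max lexx.
have x0v : x0 <= v by rewrite le_max lexx orbT.
have vw : v <= w by rewrite ge_max yw.
have av : a < v by exact: lt_le_trans x0v.
rewrite (coord_mul Hconv HMO HUC HLC Ea gw av vw ay yv).
rewrite (coord_mul Hconv HMO HUC HLC Ea gw av vw (ltW ax0) x0v).
have := pos v x0v (le_lt_trans vw wb).
by move=> h; field; lra.
Qed.

Lemma scale_common y z : y < b -> z < b ->
  exists w, [/\ x0 <= w, w < b, y <= w & z <= w].
Proof.
have /andP[ax0 x0b] := x0_itv => yb zb.
exists (Num.max x0 (Num.max y z)).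
by rewrite !le_max !gt_max !lexx ?orbT yb zb x0b.
Qed.

Lemma scale_lt y z : a <= y -> y < z -> z < b -> scale y < scale z.
Proof.
move=> ay yz zb.
have [w [x0w wb yw zw]] := scale_common (lt_trans yz zb) zb.
have [gw c0 yE] := scaleE x0w wb ay yw.
have [_ _ zE] := scaleE x0w wb (le_trans ay (ltW yz)) zw.
by rewrite -(ltr_pM2r c0) -yE -zE; apply: coord_lt.
Qed.

Lemma scale_left : scale a = 0.
Proof.
have /andP[ax0 x0b] := x0_itv.
have [gw c0] := scaleE (lexx x0) x0b (lexx a) (ltW ax0).
rewrite (coord_left Hconv HMO HUC HLC Ea gw) => /esym/eqP.
by rewrite mulf_eq0 (gt_eqF c0) orbF => /eqP.
Qed.

Lemma scale_ge0 y : a <= y -> y < b -> 0 <= scale y.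
Proof.
rewrite le_eqVlt => /orP[/eqP<-|ay] yb; first by rewrite scale_left.
by rewrite -scale_left; apply/ltW/scale_lt.
Qed.

Lemma scale_op p y z : 0 < p < 1 -> a <= y < b -> a <= z < b ->
  scale (op p y z) = p * scale y + (1 - p) * scale z.
Proof.
move=> Hp /andP[ay yb] /andP[az zb].
have [w [x0w wb yw zw]] := scale_common yb zb.
have [gw c0 yE] := scaleE x0w wb ay yw.
have [_ _ zE] := scaleE x0w wb az zw.
have a0 := Eset_ge0 Ea; have [_ w1 _] := gw.
have /andP[ao ow] : a <= op p y z <= w.
  by apply: op_between; rewrite ?ay ?az.
have [_ _ oE] := scaleE x0w wb ao ow.
apply: (mulIf (lt0r_neq0 c0)); rewrite -oE coord_op ?ay ?az// yE zE; ring.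
Qed.

Lemma scale_surj y c : a <= y -> y < b -> 0 <= c -> c <= scale y ->
  exists2 z, a <= z < b & scale z = c.
Proof.
move=> ay yb c0 cy.
have [w [x0w wb yw _]] := scale_common yb yb.
have [gw p0 yE] := scaleE x0w wb ay yw.
have [aw w1 noE] := gw.
have [/andP[_ y1] _] := coordP Hconv HMO HUC HLC Ea gw ay yw.
have Ht : 0 <= c * coord op a w x0 <= 1.
  apply/andP; split; first by rewrite mulr_ge0// ltW.
  by apply: le_trans y1; rewrite yE ler_pM2r.
have /andP[az zw] := chord_between Hconv HMO Ea aw w1 Ht.
exists (ext_op op (c * coord op a w x0) w a).
  by rewrite az (le_lt_trans zw wb).
have [_ _ zE] := scaleE x0w wb az zw.
apply: (mulIf (lt0r_neq0 p0)); rewrite -zE; exact: coordK.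
Qed.

(** It suffices that the values stay in the target and are cofinal there, since all values between 0
    and an attained one are attained. *)
Lemma scaled_isomorphism (k : R) (tau : \bar R) : 0 < k ->
  (forall y, a <= y < b -> half_open tau (k * scale y)) ->
  (forall c, half_open tau c -> exists2 y, a <= y < b & c <= k * scale y) ->
  isomorphism (`[a, b[%classic) op (half_open tau) (@plus_op R)
    (fun y => k * scale y).
Proof.
move=> k0 kin kcof; split.
  split.
  - by move=> y; rewrite /= in_itv; exact: kin.
  - move=> y z; rewrite !inE /= !in_itv /= => /andP[ay yb] /andP[az zb].
    move/(mulfI (lt0r_neq0 k0)) => yz; case: (ltgtP y z) => // h.
      by have := scale_lt ay h zb; rewrite yz ltxx.
    by have := scale_lt az h yb; rewrite yz ltxx.
  - move=> c tc; have [y /andP[ay yb] cy] := kcof _ tc.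
    have c0 : 0 <= c by case: tc.
    have [||z Hz zE] := @scale_surj y (c / k) ay yb.
    + by rewrite divr_ge0// ltW.
    + by rewrite ler_pdivrMr// mulrC.
    exists z; first by rewrite /= in_itv.
    by rewrite zE mulrC divfK// lt0r_neq0.
move=> p y z Hp; rewrite /= !in_itv /= => Hy Hz.
by rewrite scale_op// /plus_op; ring.
Qed.

Lemma half_open_isomorphism : exists2 tau, tau = 1%:E \/ tau = +oo%E &
  exists2 k : R, 0 < k & isomorphism (`[a, b[%classic) op (half_open tau)
    (@plus_op R) (fun y => k * scale y).
Proof.
have /andP[ax0 x0b] := x0_itv.
pose S := [set scale y | y in [set y | a <= y < b]].
have Sx0 : S (scale x0) by exists x0 => //=; rewrite (ltW ax0).
(* An unbounded [scale] yields the infinite [tau] with factor 1; a bounded one is divided by its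
   supremum, yielding [tau = 1]. *)
have [Sub|nSub] := pselect (has_ubound S); last first.
  exists +oo%E; [by right|exists 1 => //; apply: scaled_isomorphism => //].
    by move=> y /andP[ay yb]; rewrite half_openyE mul1r scale_ge0.
  move=> c _; apply: contrapT => H; apply: nSub; exists c => _ [y Hy <-].
  rewrite leNgt; apply/negP => cy; apply: H; exists y => //.
  by rewrite mul1r ltW.
(* The supremum is not attained, because [scale] is larger at the midpoint of [y] and [b]. *)
have supS y : a <= y < b -> scale y < sup S.
  move=> /andP[ay yb]; pose z := (y + b) / 2.
  have zb : z < b by rewrite /z; lra.
  have yz : y < z by rewrite /z; lra.
  apply: lt_le_trans (scale_lt ay yz zb) _; apply: ub_le_sup => //.
  by exists z => //=; lra.
have s0 : 0 < sup S by rewrite -scale_left; apply: supS; rewrite lexx ab.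
exists 1%:E; [by left|exists (sup S)^-1; first by rewrite invr_gt0].
apply: scaled_isomorphism; first by rewrite invr_gt0.
  move=> y Hy; rewrite half_open1E mulrC ltr_pdivrMr// mul1r supS// andbT.
  by case/andP: Hy => ay yb; rewrite divr_ge0 ?scale_ge0// ltW.
move=> c; rewrite half_open1E => /andP[c0 c1].
have e0 : 0 < sup S - c * sup S by nra.
have [|_ [y Hy <-] cy] := sup_adherent e0 (_ : has_sup S).
  by split => //; exists (scale x0).
by exists y => //; rewrite mulrC ler_pdivlMr//; lra.
Qed.

End HalfOpenGap.

End MainParts.

(** * Assembly of both parts, with uniqueness of [tau] and of the isomorphisms *)

Theorem theorem3p6 (R : realType) (op : R -> R -> R -> R)
    (Hconv : convex_algebra `[0, 1] op)
    (HMO : MO op) (HUC : UC op) (HLC : LC op) :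
  ((exists m, is_max (Eset op) m) /\
   forall m, is_max (Eset op) m -> m < 1 ->
     subalgebra `[0, 1] op `[m, 1] /\
     exists f g : R -> R,
       [/\ isomorphism `[m, 1] op `[0, 1] (@plus_op R) f,
           isomorphism `[m, 1] op `[0, 1] (@plus_op R) g,
           increasing_on `[m, 1] f,
           decreasing_on `[m, 1] g
         & ~ eq_on `[m, 1] f g /\
           forall h : R -> R,
             isomorphism `[m, 1] op `[0, 1] (@plus_op R) h ->
             eq_on `[m, 1] h f \/ eq_on `[m, 1] h g])
  /\
  (forall a b : R, Delta op (a, b) ->
     subalgebra `[0, 1] op (`[a, b[%classic) /\
     exists tau : \bar R,
       [/\ unique (fun t : \bar R =>
             (t = 1%:E \/ t = +oo%E) /\
             isomorphic (`[a, b[%classic) op (half_open t) (@plus_op R)) tau,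
           (forall f : R -> R,
             isomorphism (`[a, b[%classic) op (half_open tau) (@plus_op R) f ->
             increasing_on (`[a, b[%classic) f)
         & tau = 1%:E ->
           forall f g : R -> R,
             isomorphism (`[a, b[%classic) op (half_open tau) (@plus_op R) f ->
             isomorphism (`[a, b[%classic) op (half_open tau) (@plus_op R) g ->
             eq_on (`[a, b[%classic) f g]).
Proof.
split.
  split; first exact: Eset_max.
  move=> m [Em mub] m1; have m0 := Eset_ge0 Em.
  have sub := subalgebra_cc Hconv HMO m0; split => //.
  have g1 : eater_gap op m 1.
    by split => // y my _ /mub; rewrite leNgt my.
  have fiso := coord_isomorphism Hconv HMO HUC HLC Em g1.
  have finc := coord_increasing Hconv HMO HUC HLC Em g1.
  (* The decreasing isomorphism is the coordinate followed by the reflection of the unit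
     interval. *)
  exists (coord op m 1), (fun y => 1 - coord op m 1 y); split => //.
  - case: fiso => -[ffun finj fsurj] fop; split; last first.
      by move=> p y z Hp Xy Xz; rewrite fop// /plus_op; ring.
    split.
    + by move=> y /ffun; rewrite /= !in_itv /=; lra.
    + by move=> y z Xy Xz yz; apply: finj => //; lra.
    + move=> t Ht; have [|y Xy yE] := fsurj (1 - t).
        by move: Ht; rewrite /= !in_itv /=; lra.
      by exists y => //; rewrite yE; lra.
  - by move=> y z Xy Xz yz; have := finc y z Xy Xz yz; lra.
  - split; last by move=> h; apply: isomorphism_unit_itv fiso; case: sub.
    move=> /(_ 1); rewrite /= in_itv /= (ltW m1) lexx coord_right// => /(_ isT).
    lra.
move=> a b [/= Ea Eb ab Eab]; have a0 := Eset_ge0 Ea.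
have b1 : b <= 1 by case: Eb => /andP[].
have sub := subalgebra_co Hconv HMO a0 b1; split => //.
have Xcl := proj2 sub.
have gap x : a < x -> x < b -> eater_gap op a x.
  move=> ax xb; split => //; first exact: le_trans (ltW xb) b1.
  move=> y ay yx Ey.
  suff : (`]a, b[ `&` Eset op) y by rewrite Eab.
  by split => //; rewrite /= in_itv /= ay (le_lt_trans yx xb).
have [tau Htau [k k0 fiso]] :=
  half_open_isomorphism Hconv HMO HUC HLC Ea ab gap.
exists tau; split.
- split; first by split => //; eexists; exact: fiso.
  move=> tau' [Htau' [h hiso]].
  have [c c0 hE] := isomorphism_half_open_scale Xcl Htau Htau' fiso hiso.
  have [d d0 fE] := isomorphism_half_open_scale Xcl Htau' Htau hiso fiso.
  (* In the mixed cases, an isomorphism onto [[0, +oo)] would be a constant multiple of one with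
     values below 1, yet it attains that constant. *)
  case: Htau Htau' fiso hiso => -> [] -> // fiso hiso.
  + have [[ffun _ _] _] := fiso; have [[_ _ hsurj] _] := hiso.
    have [|y Xy yE] := hsurj c; first by rewrite half_openyE ltW.
    exfalso; have := ffun _ Xy; rewrite half_open1E.
    by have := hE _ Xy; rewrite yE; nra.
  + have [[_ _ fsurj] _] := fiso; have [[hfun _ _] _] := hiso.
    have [|y Xy yE] := fsurj d; first by rewrite half_openyE ltW.
    exfalso; have := hfun _ Xy; rewrite half_open1E.
    by have := fE _ Xy; rewrite yE; nra.
- move=> h hiso y z; rewrite /= => Xy Xz yz.
  have [c c0 hE] := isomorphism_half_open_scale Xcl Htau Htau fiso hiso.
  rewrite !hE// !ltr_pM2l//.
  move: Xy Xz; rewrite /= !in_itv /= => /andP[ay _] /andP[_ zb].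
  exact: (scale_lt Hconv HMO HUC HLC Ea ab gap).
- move=> tau1 f g giso hiso y Xy.
  have [c c0 cE] := isomorphism_half_open_scale Xcl Htau Htau giso hiso.
  have [d d0 dE] := isomorphism_half_open_scale Xcl Htau Htau hiso giso.
  move: giso hiso; rewrite tau1 => -[[gfun _ gsurj] _] [[hfun _ hsurj] _].
  suff -> : g y = f y by [].
  rewrite cE//; suff -> : c = 1 by rewrite mul1r.
  (* If [c < 1], a point where [g] equals [c] has [f] equal to 1; if [c > 1], a point where [f]
     equals [c^-1] has [g] equal to 1. Neither value lies in [[0, 1)]. *)
  case: (ltgtP c 1) => // c1.
  + have [|z Xz zE] := hsurj c; first by rewrite half_open1E; lra.
    have := gfun _ Xz; rewrite half_open1E.
    by have := cE _ Xz; rewrite zE; nra.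
  + have [|z Xz zE] := gsurj c^-1.
      by rewrite half_open1E invf_lt1 ?invr_ge0 ?ltW//; lra.
    have := hfun _ Xz; rewrite half_open1E cE// zE divff ?gt_eqF// ltxx.
    by rewrite andbF.
Qed.
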